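(* Let $\lambda=(\lambda_1,\dots,\lambda_k)$ be a composition of $n$. The poset $C_\lambda$ (with the restriction of the Bruhat-Chevalley order of $S_n$) is unimodal and rank-symmetric, and moreover $$\sum_{\pi\in C_\lambda}q^{inv(\pi)}=[i_1]_q[i_2]_q\cdots[i_m]_q$$ for a certain sequence of integers $2\le i_1<i_2<\cdots<i_m\le n-1$.
   Context: $S_n$ is the symmetric group on $[n]$. The standard cyclic form of $\pi\in S_n$ is its expression as a product of disjoint cycles, with cycles of length one NOT omitted, each cycle beginning with its smallest entry, and cycles ordered by increasing first entries; the composition type of $\pi$ is the sequence of cycle lengths in this order. $\Omega:S_n\to S_n$ sends $\pi$ to the permutation whose one-line notation is the word obtained by deleting the parentheses from the standard cyclic form of $\pi$. For $\lambda\vDash n$, $C_\lambda:=\Omega(A_\lambda)$ where $A_\lambda$ is the set of permutations of composition type $\lambda$. $inv(x)=|\{(i,j):i<j,\ x(i)>x(j)\}|$, and the Bruhat-Chevalley order on $S_n$ is the transitive closure of $x<y$ where $y$ is obtained from $x$ by swapping two entries $a_i<a_j$ at positions $i<j$ with $inv(y)=inv(x)+1$; $C_\lambda$ is graded with rank function $inv$. $[r]_q=1+q+\cdots+q^{r-1}$. If $r_i$ is the number of elements of rank $i$ and $M$ is the rank of the maximum, rank-symmetric means $r_i=r_{M-i}$ for all $i$, and unimodal means $r_0\le\cdots\le r_{\lfloor M/2\rfloor}\ge\cdots\ge r_M$. *)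

(* Defs.v *)
From mathcomp Require Import all_boot all_order all_algebra all_fingroup.

Set Implicit Arguments.
Unset Strict Implicit.
Unset Printing Implicit Defensive.

Import GRing.Theory.

(* [n] is encoded as 'I_n = {0, ..., n-1}; one-line notation of w is
   w 0, w 1, ..., w (n-1). *)

Definition is_composition (n : nat) (lam : seq nat) : Prop :=
  all (leq 1) lam /\ sumn lam = n.

Section StandardCyclicForm.
Variable n : nat.
Implicit Types p w : 'S_n.

Definition cycle_min p (x : 'I_n) : bool := [forall y in porbit p x, x <= y].

Definition cycle_word p (x : 'I_n) : seq 'I_n := traject p x #|porbit p x|.

(* enum 'I_n is increasing, so the cycles come in increasing order of their
   first (smallest) entries; fixed points give cycles of length one. *)
Definition standard_cyclic_form p : seq (seq 'I_n) :=
  [seq cycle_word p x | x <- enum 'I_n & cycle_min p x].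

Definition composition_type p : seq nat := shape (standard_cyclic_form p).

Definition Omega_word p : seq 'I_n := flatten (standard_cyclic_form p).

Lemma mem_cycle_word p x y : (y \in cycle_word p x) = (y \in porbit p x).
Proof. by rewrite /cycle_word porbit_traject. Qed.

Lemma mem_Omega_word p y : y \in Omega_word p.
Proof.
have yy : y \in porbit p y by rewrite porbit_id.
case: (arg_minnP (fun z : 'I_n => val z) yy) => x xy minx.
apply/flattenP; exists (cycle_word p x); last first.
  by rewrite mem_cycle_word porbit_sym.
apply/mapP; exists x => //.
rewrite mem_filter mem_enum andbT.
apply/forallP => z; apply/implyP => zx; apply: minx.
suff: z \in porbit p y by [].
have {}xy : x \in porbit p y := xy.
by move: zx xy; rewrite -!eq_porbit_mem => /eqP -> /eqP ->.
Qed.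

Lemma Omega_word_uniq p : uniq (Omega_word p).
Proof.
rewrite /Omega_word /standard_cyclic_form.
have : uniq [seq x <- enum 'I_n | cycle_min p x] by rewrite filter_uniq ?enum_uniq.
have : all (cycle_min p) [seq x <- enum 'I_n | cycle_min p x] by rewrite filter_all.
elim: [seq x <- _ | _] => //= x s IHs /andP[mx ms] /andP[xs us].
rewrite cat_uniq IHs // andbT uniq_traject_porbit /=.
apply/hasPn => y /flattenP[_ /mapP[z zs ->]].
rewrite mem_cycle_word => yz; apply/negP => /=; rewrite mem_cycle_word => yx.
have xz : porbit p x = porbit p z.
  by move: yx yz; rewrite -!eq_porbit_mem => /eqP <- /eqP <-.
have mz := allP ms z zs.
case/negP: xs; suff -> : x = z by [].
apply/val_inj/eqP; rewrite eqn_leq.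
move/forallP/(_ z)/implyP: mx; rewrite xz porbit_id => -> //.
by move/forallP/(_ x)/implyP: mz; rewrite -xz porbit_id => ->.
Qed.

Lemma size_Omega_word p : size (Omega_word p) = n.
Proof.
rewrite -(card_uniqP (Omega_word_uniq p)) -[RHS](card_ord n).
by apply: eq_card => y; rewrite mem_Omega_word.
Qed.

Definition Omega_fun p (i : 'I_n) : 'I_n := nth i (Omega_word p) i.

Lemma Omega_fun_inj p : injective (Omega_fun p).
Proof.
move=> i j; rewrite /Omega_fun (set_nth_default i j) ?size_Omega_word //.
by move/eqP; rewrite nth_uniq ?size_Omega_word ?Omega_word_uniq // => /eqP /val_inj.
Qed.

Definition Omega p : 'S_n := perm (@Omega_fun_inj p).

Lemma Omega_one_line p (x0 i : 'I_n) : Omega p i = nth x0 (Omega_word p) i.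
Proof.
by rewrite permE; apply: set_nth_default; rewrite size_Omega_word.
Qed.

Definition A_ (lam : seq nat) : {set 'S_n} := [set p | composition_type p == lam].

Definition C_ (lam : seq nat) : {set 'S_n} := Omega @: A_ lam.

Definition ninv w : nat :=
  #|[set ij : 'I_n * 'I_n | (ij.1 < ij.2) && (w ij.2 < w ij.1)]|.

(* (tperm i j * x) k = x (tperm i j k): the entries at positions i and j
   are exchanged. *)
Definition bruhat_step : rel 'S_n := fun x y =>
  [exists i : 'I_n, exists j : 'I_n,
     [&& i < j, x i < x j, y == (tperm i j * x)%g & ninv y == (ninv x).+1]].

Definition bruhat : rel 'S_n := connect bruhat_step.

End StandardCyclicForm.

Section RankedPosets.
(* The poset under consideration is the subset C with the restriction of le. *)
Variables (T : finType) (le : rel T) (rk : T -> nat) (C : {set T}).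

Definition minimal_in (x : T) : Prop :=
  x \in C /\ forall y, y \in C -> le y x -> y = x.

Definition maximum_in (x : T) : Prop :=
  x \in C /\ forall y, y \in C -> le y x.

Definition covers_in (x y : T) : Prop :=
  [/\ x \in C, y \in C, x != y, le x y
    & forall z, z \in C -> le x z -> le z y -> z = x \/ z = y].

Definition rank_function : Prop :=
  (forall x, minimal_in x -> rk x = 0) /\
  (forall x y, covers_in x y -> rk y = (rk x).+1).

Definition rank_number (i : nat) : nat := #|[set x in C | rk x == i]|.

Definition rank_symmetric : Prop :=
  rank_function /\
  exists2 m, maximum_in m &
    forall i, i <= rk m -> rank_number i = rank_number (rk m - i).

Definition rank_unimodal : Prop :=
  rank_function /\
  exists2 m, maximum_in m &
    (forall i, i < (rk m)./2 -> rank_number i <= rank_number i.+1) /\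
    (forall i, (rk m)./2 <= i < rk m -> rank_number i.+1 <= rank_number i).

End RankedPosets.

Definition qint (r : nat) : {poly int} := (\sum_(j < r) 'X^j)%R.

(* Main.v *)
Require Import Defs.
From mathcomp Require Import all_boot all_order all_algebra all_fingroup.
From mathcomp Require Import zify.

Set Implicit Arguments.
Unset Strict Implicit.
Unset Printing Implicit Defensive.

Import GRing.Theory Num.Theory Order.TTheory.

(* A word lies in C_lambda iff every entry at the start of a block is smaller
   than all the entries to its right.  Hence the Lehmer code is forced to be 0
   at the block starts and is arbitrary elsewhere, which gives the product of
   q-integers; such products are symmetric and unimodal.

   For gradedness, let x < y be in C_lambda, let a be the first position where
   they differ, and let b > a be the first one with x(a) < x(b) <= y(a).  Swapping
   the entries of x at a and b gives a Bruhat cover of x lying below y.  No entry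
   between the two positions has an intermediate value, so the swap stays in
   C_lambda.  The same kind of swap leads from any element of C_lambda up to the
   unique one whose entries off the block starts exceed all those to their
   right, which is therefore the maximum. *)

(** * Bruhat order *)

Section Bruhat.
Variable n : nat.
Implicit Types (x y z w : 'S_n) (a b c i j : 'I_n).

Lemma ninv_sum w : ninv w = \sum_(i : 'I_n) \sum_(j : 'I_n) ((i < j) && (w j < w i) : nat).
Proof.
rewrite /ninv -sum1_card pair_big /= big_mkcond /=.
by apply: eq_bigr => -[i j] _; rewrite inE /=; case: ifP.
Qed.

Lemma big_ord_D2 a b (F : 'I_n -> nat) : a != b ->
  \sum_i F i = F a + (F b + \sum_(i | (i != a) && (i != b)) F i).
Proof.
by move=> ab; rewrite (bigD1 a) //= (bigD1 b) //= eq_sym.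
Qed.

(** The pair of positions [a], [b] becomes an inversion. Any other position [c] could change the
    count only by lying strictly between them both in position and in value, which the gap
    hypothesis excludes. *)
Lemma ninv_tperm x a b : a < b -> x a < x b ->
  (forall c, a < c -> c < b -> ~~ (x a < x c < x b)) ->
  ninv (tperm a b * x)%g = (ninv x).+1.
Proof.
move=> ab xab gap; have neq_ab : a != b by apply/eqP=> e; rewrite e ltnn in ab.
(* Reindexing both sums by the transposition moves the swap from the entries to the positions. *)
have ninvE : ninv (tperm a b * x)%g =
    \sum_(i : 'I_n) \sum_(j : 'I_n) ((tperm a b i < tperm a b j) && (x j < x i) : nat).
  rewrite ninv_sum (reindex_inj (@perm_inj _ (tperm a b))) /=.
  apply: eq_bigr => i _; rewrite (reindex_inj (@perm_inj _ (tperm a b))) /=.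
  by apply: eq_bigr => j _; rewrite !permM !tpermK.
rewrite ninvE ninv_sum !(big_ord_D2 _ neq_ab) tpermL tpermR.
have tpermO c : (c != a) && (c != b) -> tperm a b c = c.
  by case/andP=> ca cb; rewrite tpermD // eq_sym.
set S := fun (a1 b1 : 'I_n) => \sum_(j | (j != a) && (j != b)) ((a1 < j) && (x j < x b1) : nat).
(* For each [c] the two sides differ, up to sign, by the product of the indicators of [a < c <= b]
   and [x a <= x c < x b]. *)
have rows : S b a + S a b = S a a + S b b.
  rewrite /S -!big_split /=; apply: eq_bigr => c /andP[ca cb].
  have := gap c; have : val c != val a by []. have : val c != val b by [].
  have : val (x c) != val (x a) by rewrite (inj_eq val_inj) (inj_eq perm_inj).
  have : val (x c) != val (x b) by rewrite (inj_eq val_inj) (inj_eq perm_inj).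
  rewrite /=; lia.
have rowE a1 b1 :
    \sum_(i | (i != a) && (i != b)) ((a1 < tperm a b i) && (x i < x b1) : nat) = S a1 b1.
  by apply: eq_bigr => c /tpermO ->.
rewrite !rowE.
have rest :
  \sum_(i | (i != a) && (i != b))
    \sum_(j : 'I_n) ((tperm a b i < tperm a b j) && (x j < x i) : nat) =
  \sum_(i | (i != a) && (i != b)) \sum_(j : 'I_n) ((i < j) && (x j < x i) : nat).
  apply: eq_bigr => c Hc; rewrite !(big_ord_D2 _ neq_ab) tpermL tpermR (tpermO _ Hc).
  have -> : \sum_(i | (i != a) && (i != b)) ((c < tperm a b i) && (x i < x c) : nat) =
    \sum_(i | (i != a) && (i != b)) ((c < i) && (x i < x c) : nat).
    by apply: eq_bigr => d /tpermO ->.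
  case/andP: Hc => ca cb.
  have := gap c; have : val c != val a by []. have : val c != val b by [].
  have : val (x c) != val (x a) by rewrite (inj_eq val_inj) (inj_eq perm_inj).
  have : val (x c) != val (x b) by rewrite (inj_eq val_inj) (inj_eq perm_inj).
  rewrite /=; lia.
rewrite rest /=; move: rows xab ab.
rewrite -/(S a a) -/(S b b) => rows xab ab.
by rewrite !ltnn ab xab ltnNge (ltnW ab) /= ltnNge (ltnW xab) /=; lia.
Qed.

Lemma bruhat_step_tperm x a b : a < b -> x a < x b ->
  (forall c, a < c -> c < b -> ~~ (x a < x c < x b)) ->
  bruhat_step x (tperm a b * x)%g.
Proof.
move=> ab xab gap; apply/existsP; exists a; apply/existsP; exists b.
by rewrite ab xab eqxx ninv_tperm // eqxx.
Qed.

Lemma bruhat_ninv x y : bruhat x y -> x = y \/ ninv x < ninv y.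
Proof.
move/connectP => [s]; elim: s x => [|z s IH] x /=; first by move=> _ ->; left.
case/andP => /existsP[i /existsP[j /and4P[_ _ _ /eqP e]]] /IH {}IH /IH [zy|zy]; right.
  by rewrite -zy e.
by apply: ltn_trans zy; rewrite e.
Qed.

(* The number of dots of the permutation matrix of [w] in an upper right corner;
   Bruhat order is comparison of these numbers. *)
Definition corner w (k v : nat) : nat := \sum_(i : 'I_n | i < k) (v <= w i : nat).

Definition corner_le x y : Prop := forall k v, corner x k v <= corner y k v.

(** The first [k] entries change as a multiset only when [k] separates [a] from [b]; then [x a] is
    replaced by [x b]. *)
Lemma corner_tperm x a b k v : a < b -> x a < x b ->
  corner (tperm a b * x)%g k v =
  corner x k v + ((a < k <= b) && (x a < v <= x b) : nat).
Proof.
move=> ab xab; have neq_ab : a != b by apply/eqP=> e; rewrite e ltnn in ab.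
rewrite /corner !(big_mkcond (fun i : 'I_n => i < k)) /= !(big_ord_D2 _ neq_ab).
rewrite !permM tpermL tpermR.
have -> : \sum_(i | (i != a) && (i != b)) (if i < k then (v <= (tperm a b * x)%g i : nat) else 0) =
  \sum_(i | (i != a) && (i != b)) (if i < k then (v <= x i : nat) else 0).
  by apply: eq_bigr => c /andP[ca cb]; rewrite permM tpermD // eq_sym.
by do 2 case: ifP; lia.
Qed.

Lemma bruhat_corner_le x y : bruhat x y -> corner_le x y.
Proof.
move/connectP => [s]; elim: s x => [|z s IH] x /=; first by move=> _ -> k v.
case/andP => /existsP[i /existsP[j /and4P[ij xij /eqP e _]]] /IH {}IH /IH zy k v.
by apply: leq_trans (zy k v); rewrite e corner_tperm // leq_addr.
Qed.

(** The identity packs as many values below [v] as possible into the first [k] positions, hence has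
    the fewest values [>= v] there. *)
Lemma corner_id_le y : corner_le 1%g y.
Proof.
move=> k v.
pose small w := \sum_(i : 'I_n | i < k) (w i < v : nat).
have cornerD w : corner w k v + small w = \sum_(i : 'I_n | i < k) 1.
  by rewrite /corner /small -big_split /=; apply: eq_bigr => i _; lia.
suff : small y <= small 1%g by have := cornerD y; have := cornerD 1%g; lia.
rewrite /small; case: (leqP k v) => kv.
  apply: leq_sum => i ik; rewrite perm1 (leq_trans ik kv); exact: leq_b1.
have -> : \sum_(i : 'I_n | i < k) ((1 : 'S_n)%g i < v : nat) = \sum_(i : 'I_n) (i < v : nat).
  rewrite big_mkcond /=; apply: eq_bigr => i _; rewrite perm1; case: ifP => //; lia.
rewrite [leqRHS](reindex_inj (@perm_inj _ y)) /= big_mkcond /=.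
by apply: leq_sum => i _; case: (i < k).
Qed.

(** * Permutations with prescribed right-to-left minima *)

(** Marked positions are a predicate on [nat], so that they can be shifted when the first entry is
    removed, and taken to be [pred0] to obtain all of [S_n]. *)
Definition right_min (P : pred nat) : {set 'S_n} :=
  [set w : 'S_n | [forall i : 'I_n, forall j : 'I_n, P i && (i < j) ==> (w i < w j)]].

Lemma right_minP (P : pred nat) w :
  reflect (forall i j, P i -> i < j -> w i < w j) (w \in right_min P).
Proof.
rewrite inE; apply: (iffP forallP) => H i.
  by move=> j Pi ij; move/forallP/(_ j)/implyP: (H i); rewrite Pi ij; apply.
by apply/forallP => j; apply/implyP => /andP[]; apply: H.
Qed.

Lemma val_perm_eq x i j : (val (x i) == val (x j)) = (i == j).
Proof. by rewrite (inj_eq val_inj) (inj_eq perm_inj). Qed.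

(** The entry that grows sits at the unmarked [a]. The entry at [b] drops to [x a], which could harm
    only a marked [i] strictly between; there [x i < x b], so the gap hypothesis forces
    [x i < x a]. *)
Lemma right_min_tperm (P : pred nat) x a b : x \in right_min P -> ~~ P a ->
  a < b -> x a < x b ->
  (forall c, a < c -> c < b -> ~~ (x a < x c < x b)) ->
  (tperm a b * x)%g \in right_min P.
Proof.
move=> /right_minP xP Pa ab xab gap; apply/right_minP => i j Pi ij.
rewrite !permM.
have [ia|ia] := eqVneq i a; first by rewrite -ia Pi in Pa.
have [eib|ib] := eqVneq i b.
  subst i; rewrite tpermR tpermD; first exact: ltn_trans xab (xP _ _ Pi ij).
    by apply/eqP => e; subst j; move: ij ab; rewrite ltnNge => /negP + /ltnW.
  by apply/eqP => e; subst j; rewrite ltnn in ij.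
rewrite (tpermD (z := i)) 1?eq_sym //.
have [eja|ja] := eqVneq j a.
  by subst j; rewrite tpermL; apply: xP => //; apply: ltn_trans ij ab.
have [ejb|jb] := eqVneq j b; last first.
  by rewrite tpermD 1?eq_sym //; apply: xP.
subst j; rewrite tpermR; have [ai|ai] := ltnP a i; last first.
  by apply: xP; rewrite // ltn_neqAle ai andbT.
have := gap i ai ij; have := xP _ _ Pi ij; have := val_perm_eq x i a.
by rewrite (negbTE ia) /=; lia.
Qed.

(** Used twice: with no marked positions it shows that the corner comparison implies Bruhat order,
    and in general it shows that covers raise [ninv] by one. *)
Lemma right_min_bruhat_step (P : pred nat) x y : x \in right_min P -> y \in right_min P ->
  corner_le x y -> x != y ->
  exists z, [/\ z \in right_min P, bruhat_step x z & corner_le z y].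
Proof.
move=> xP yP le_xy neq_xy.
have [a0 a0P] : exists i, x i != y i.
  apply/existsP; apply: contraNT neq_xy; rewrite negb_exists => /forallP H.
  by apply/eqP/permP => i; apply/eqP; have := H i; rewrite negbK.
case: (@arg_minnP _ a0 (fun i => x i != y i) val a0P) => a aP a_min {a0 a0P}.
have pre i : i < a -> x i = y i.
  by move=> ia; apply/eqP; apply: contraTT ia => /a_min; rewrite -leqNgt.
have cornerS w v (k : nat) : a < k -> corner w k v =
    corner w a v + ((v <= w a : nat) + \sum_(i : 'I_n | a < i < k) (v <= w i : nat)).
  move=> ak; rewrite /corner !(big_mkcond (fun i : 'I_n => i < _)) /=.
  rewrite (bigD1 a) //= ak [RHS]addnCA; congr (_ + _).
  rewrite [in LHS]big_mkcond [X in _ + X]big_mkcond -big_split /=.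
  apply: eq_bigr => i _; have [->|ia] := eqVneq i a; first by rewrite /= !ltnn.
  have {}ia : val i != val a by [].
  by rewrite /= in ia *; case: (ltngtP i a) ia => //= ai; case: (ltnP i k) => //=; lia.
have corner_pre v : corner x a v = corner y a v.
  by apply: eq_bigr => i /pre ->.
have lt_xy : x a < y a.
  (* The words agree before [a], so the corner just past [a] with threshold [x a] compares only the
     entries at [a]. *)
  have := le_xy a.+1 (x a); rewrite !(cornerS _ _ a.+1) // corner_pre leqnn.
  rewrite !big_pred0; try by move=> i; lia.
  by move: aP; rewrite -(inj_eq val_inj) /=; lia.
(* The position of the value [y a] in [x] is a candidate for [b], so a minimal one exists. *)
pose b0 := (x^-1)%g (y a).
have xb0 : x b0 = y a by rewrite permKV.
have b0P : (a < b0) && (x a < x b0 <= y a).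
  rewrite xb0 lt_xy leqnn !andbT ltnNge leq_eqVlt negb_or.
  apply/andP; split.
    by apply: contraNN aP => /eqP/val_inj e; rewrite -xb0 e.
  by apply/negP => b0a; have := pre _ b0a; rewrite xb0 => /perm_inj e; rewrite -e ltnn in b0a.
case: (@arg_minnP _ b0 (fun i : 'I_n => (a < i) && (x a < x i <= y a)) val b0P) => b.
move=> /and3P[ab xab xby] b_min {b0 b0P xb0}.
have gap c : a < c -> c < b -> ~~ (x a < x c <= y a).
  by move=> ac; apply: contraTN => h; rewrite -leqNgt; apply: b_min; rewrite ac.
have gap' c : a < c -> c < b -> ~~ (x a < x c < x b).
  by move=> ac cb; have := gap c ac cb; lia.
(* Were [a] marked, the value [x a], which [y] must carry to the right of [a], would exceed
   [y a]. *)
have Pa : ~~ P a.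
  apply/negP => Pa.
  pose c := (y^-1)%g (x a); have yc : y c = x a by rewrite permKV.
  case: (ltngtP a c) => [ac|ca|/val_inj ac].
  - by have := right_minP _ _ yP _ _ Pa ac; rewrite yc; lia.
  - by have := pre _ ca; rewrite yc => /perm_inj e; rewrite e ltnn in ca.
  - by rewrite -yc ac eqxx in aP.
exists (tperm a b * x)%g; split; first exact: right_min_tperm.
  exact: bruhat_step_tperm.
move=> k v; rewrite corner_tperm //.
case: (boolP ((a < k <= b) && (x a < v <= x b))) => [|_]; last by rewrite addn0.
move=> /andP[/andP[ak kb] /andP[xav vxb]].
(* Strictly between [a] and [k] no entry of [x] lies in [(x a, y a]], so for [x] the thresholds [v]
   and [(y a).+1] count the same there. For [y] the lower threshold [v] counts in addition the entry
   [y a] itself, which supplies the missing unit. *)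
have := le_xy k (y a).+1; rewrite !(cornerS _ _ k) // ltnn.
have -> : (y a < x a) = false by lia.
have -> : (v <= x a) = false by lia.
have -> : v <= y a by lia.
have -> : \sum_(i : 'I_n | a < i < k) (v <= x i : nat) =
    \sum_(i : 'I_n | a < i < k) (y a < x i : nat).
  by apply: eq_bigr => i /andP[ai ik]; have := gap i ai (leq_trans ik kb); lia.
have : \sum_(i : 'I_n | a < i < k) (y a < y i : nat) <=
    \sum_(i : 'I_n | a < i < k) (v <= y i : nat).
  by apply: leq_sum => i _; lia.
rewrite !corner_pre /=; lia.
Qed.

(** A crude bound that makes [n * n - ninv x] a decreasing measure along upward steps. *)
Lemma ninv_max x : ninv x <= n * n.
Proof. by apply: leq_trans (max_card _) _; rewrite card_prod !card_ord. Qed.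

Lemma bruhat_step_ninv x y : bruhat_step x y -> ninv y = (ninv x).+1.
Proof. by case/existsP=> i /existsP[j /and4P[_ _ _ /eqP]]. Qed.

Lemma corner_le_bruhat x y : corner_le x y -> bruhat x y.
Proof.
have [k] := ubnP (n * n - ninv x); elim: k x => // k IH x lek xy.
have [->|neq] := eqVneq x y; first exact: connect0.
have inT w : w \in right_min pred0 by apply/right_minP.
have [z [_ xz zy]] := right_min_bruhat_step (inT x) (inT y) xy neq.
apply: connect_trans (connect1 xz) (IH z _ zy).
by have := ninv_max z; rewrite (bruhat_step_ninv xz); lia.
Qed.

Lemma ninv_id : ninv (1%g : 'S_n) = 0.
Proof. by apply: eq_card0 => -[i j]; rewrite !inE /= !perm1; lia. Qed.

Lemma right_min_id (P : pred nat) : 1%g \in right_min P.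
Proof. by apply/right_minP => i j _; rewrite !perm1. Qed.

(** The identity lies below everything, so it is the only minimal element. For a cover, the
    intermediate element one step above [x] can only be [y]. *)
Lemma right_min_rank_function (P : pred nat) :
  rank_function (@bruhat n) (@ninv n) (right_min P).
Proof.
split=> [x [xP x_min]|x y [xP yP neq xy cov]].
  rewrite -(x_min _ (right_min_id P)); last exact/corner_le_bruhat/corner_id_le.
  exact: ninv_id.
have [z [zP xz zy]] := right_min_bruhat_step xP yP (bruhat_corner_le xy) neq.
rewrite -(bruhat_step_ninv xz).
case: (cov z zP (connect1 xz) (corner_le_bruhat zy)) => [e|-> //].
by have := bruhat_step_ninv xz; rewrite e; lia.
Qed.

(** * Climbing to the maximum *)

Lemma right_min_step_up (P : pred nat) x a b0 : x \in right_min P -> ~~ P a ->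
  a < b0 -> x a < x b0 -> exists2 z, z \in right_min P & bruhat_step x z.
Proof.
move=> xP Pa ab0 xab0.
(* Here [b] carries the smallest entry to the right of [a] that exceeds [x a], so the gap condition
   is automatic. *)
case: (@arg_minnP _ b0 (fun i : 'I_n => (a < i) && (x a < x i)) (fun i => val (x i))).
  by rewrite ab0.
move=> b /andP[ab xab] b_min.
have gap c : a < c -> c < b -> ~~ (x a < x c < x b).
  move=> ac _; apply/negP => /andP[xac]; rewrite ltnNge => /negP; apply.
  by apply: b_min; rewrite ac.
by exists (tperm a b * x)%g; [apply: right_min_tperm | apply: bruhat_step_tperm].
Qed.

Definition right_extremal (P : pred nat) w : Prop :=
  w \in right_min P /\ forall i j, ~~ P i -> i < j -> w j < w i.

Lemma right_extremal_above (P : pred nat) x : x \in right_min P ->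
  exists2 m, right_extremal P m & bruhat x m.
Proof.
have [k] := ubnP (n * n - ninv x); elim: k x => // k IH x lek xP.
case: (boolP [exists i : 'I_n, exists j : 'I_n, [&& ~~ P i, i < j & x i < x j]]).
  case/existsP=> a /existsP[b /and3P[Pa ab xab]].
  have [z zP xz] := right_min_step_up xP Pa ab xab.
  have [|m mP zm] := IH z _ zP.
    by have := ninv_max z; rewrite (bruhat_step_ninv xz); lia.
  by exists m => //; apply: connect_trans (connect1 xz) zm.
rewrite negb_exists => /forallP H; exists x; last exact: connect0.
split=> // i j Pi ij; have := H i; rewrite negb_exists => /forallP/(_ j).
have := val_perm_eq x i j; have -> : (i == j) = false by apply/eqP => e; rewrite e ltnn in ij.
rewrite Pi ij /=; lia.
Qed.

(** Read from left to right, every entry is forced: the smallest remaining value at a marked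
    position, the largest at an unmarked one. *)
Lemma right_extremal_uniq (P : pred nat) x y : right_extremal P x -> right_extremal P y -> x = y.
Proof.
move=> [/right_minP xmin xmax] [/right_minP ymin ymax]; apply/permP.
suff H : forall k, forall i : 'I_n, i < k -> x i = y i by move=> i; apply: (H n).
elim=> // k IH i; rewrite ltnS leq_eqVlt => /orP[/eqP ik|]; last exact: IH.
(* By induction neither [x i] in [y] nor [y i] in [x] can occur before [i]; extremality then
   compares the two values in opposite ways. *)
pose c := (y^-1)%g (x i); have yc : y c = x i by rewrite permKV.
pose d := (x^-1)%g (y i); have xd : x d = y i by rewrite permKV.
case: (ltngtP c i) => [ci|ic|/val_inj e]; last by rewrite -yc e.
  by have e := IH c; rewrite -ik ci yc in e; have := e isT => /perm_inj xx; rewrite xx ltnn in ci.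
case: (ltngtP d i) => [di|id|/val_inj e]; last by rewrite -xd e.
  by have e := IH d; rewrite -ik di xd in e; have := e isT => /perm_inj xx; rewrite xx ltnn in di.
case: (boolP (P i)) => Pi.
  by have := xmin _ _ Pi id; have := ymin _ _ Pi ic; rewrite yc xd; lia.
by have := xmax _ _ Pi id; have := ymax _ _ Pi ic; rewrite yc xd; lia.
Qed.

Lemma right_min_maximum (P : pred nat) :
  exists m, maximum_in (@bruhat n) (right_min P) m.
Proof.
have [m mP _] := right_extremal_above (right_min_id P); exists m; split; first by case: mP.
by move=> y /right_extremal_above[m' m'P]; rewrite (right_extremal_uniq m'P mP).
Qed.

End Bruhat.

(** * Generating function *)

Lemma lift_perm_inj n (i v : 'I_n.+1) : injective (@lift_perm n i v).
Proof.
move=> s t est; apply/permP => k; apply: (@lift_inj _ v).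
by rewrite -!(lift_perm_lift i) est.
Qed.

(** Here [s] is obtained by removing the entry at [i] and closing the gap left in the values. *)
Lemma lift_perm_onto n (i : 'I_n.+1) (w : 'S_n.+1) :
  exists s, w = lift_perm i (w i) s.
Proof.
have w_lift k : {k' | w (lift i k) = lift (w i) k'}.
  case: (unliftP (w i) (w (lift i k))) => [k' e|/perm_inj e]; first by exists k'.
  by have := neq_lift i k; rewrite e eqxx.
have f_inj : injective (fun k => sval (w_lift k)).
  move=> k l e; apply: (@lift_inj _ i); apply: (@perm_inj _ w).
  by rewrite (svalP (w_lift k)) (svalP (w_lift l)) e.
exists (perm f_inj); apply/permP => k.
case: (unliftP i k) => [k'|] ->; last by rewrite lift_perm_id.
by rewrite lift_perm_lift permE; apply: (svalP (w_lift k')).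
Qed.

Lemma lift_ltn n (v : 'I_n.+1) (i j : 'I_n) : (lift v i < lift v j) = (i < j).
Proof. by rewrite /= /bump; lia. Qed.

(** The first entry [v] exceeds exactly [v] later ones, and lifting preserves the relative order of
    the rest. *)
Lemma ninv_lift_perm n (v : 'I_n.+1) (s : 'S_n) :
  ninv (lift_perm ord0 v s) = v + ninv s.
Proof.
rewrite !ninv_sum big_ord_recl; congr (_ + _).
  rewrite big_ord_recl /= lift_perm_id.
  rewrite (eq_bigr (fun j : 'I_n => (s j < v : nat))); last first.
    by move=> j _; rewrite lift_perm_lift /= /bump; lia.
  have -> : \sum_(j < n) (s j < v : nat) = \sum_(j < n) (j < v : nat).
    by rewrite [RHS](reindex_inj (@perm_inj _ s)).
  rewrite add0n.
  have vn : v <= n by rewrite -ltnS.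
  rewrite -(big_mkord xpredT (fun j => (j < v : nat))) (big_cat_nat _ vn) //=.
  rewrite big_nat (eq_bigr (fun=> 1)); last by move=> j /andP[_ ->].
  rewrite -big_nat sum_nat_const_nat big_nat big1 ?subn0; first by lia.
  by move=> j /andP[vj _]; lia.
apply: eq_bigr => i _; rewrite big_ord_recl /= add0n.
by apply: eq_bigr => j _; rewrite !lift_perm_lift lift_ltn /bump /=; lia.
Qed.

Lemma right_min_lift_perm n (P : pred nat) (v : 'I_n.+1) (s : 'S_n) :
  (lift_perm ord0 v s \in right_min _ P) =
  (P 0 ==> (v == ord0)) && (s \in right_min _ (fun i => P i.+1)).
Proof.
apply/right_minP/andP => [H|[/implyP H0 /right_minP Hs] i j].
  split.
    apply/implyP => P0.
    (* Locate the value 0: at a later position it would violate the marking of position 0. *)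
    have := permKV (lift_perm ord0 v s) ord0.
    case: (unliftP ord0 ((lift_perm ord0 v s)^-1%g ord0)) => [k ->|->] e.
      by have := H ord0 (lift ord0 k) P0 isT; rewrite e.
    by rewrite -e lift_perm_id.
  apply/right_minP => i j Pi ij; have := H (lift ord0 i) (lift ord0 j) Pi.
  by rewrite !lift_perm_lift !lift_ltn; apply.
case: (unliftP ord0 i) => [i' ->|->]; case: (unliftP ord0 j) => [j' ->|->] //.
  by rewrite !lift_perm_lift !lift_ltn; apply: Hs.
by rewrite lift_perm_lift lift_perm_id => /H0/eqP ->.
Qed.

(** Classify by the first entry: it is 0 at a marked position, and otherwise any [v], contributing
    ['X^v]. *)
Lemma right_min_gf_rec n (P : pred nat) :
  (\sum_(w in right_min n.+1 P) 'X^(ninv w) =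
   (if P 0 then 1 else qint n.+1) *
   \sum_(w in right_min n (fun i => P i.+1)) 'X^(ninv w) :> {poly int})%R.
Proof.
rewrite (partition_big (fun w : 'S_n.+1 => w ord0) (fun v => P 0 ==> (v == ord0))) /=; last first.
  move=> w; have [s ws] := lift_perm_onto ord0 w.
  by rewrite {1}ws right_min_lift_perm => /andP[].
transitivity (\sum_(v < n.+1 | P 0 ==> (v == ord0)) 
  ('X^v * \sum_(w in right_min n (fun i => P i.+1)) 'X^(ninv w)) : {poly int})%R.
  apply: eq_bigr => v Pv; rewrite big_distrr /=.
  have imE : [pred w | (w \in right_min n.+1 P) && (w ord0 == v)] =i
      lift_perm ord0 v @: right_min n (fun i => P i.+1).
    move=> w; rewrite inE /=; apply/andP/imsetP => [[wP /eqP wv]|[s sP ->]].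
      have [s ws] := lift_perm_onto ord0 w; rewrite wv in ws.
      by exists s => //; move: wP; rewrite ws right_min_lift_perm => /andP[].
    by rewrite right_min_lift_perm Pv sP lift_perm_id.
  rewrite (eq_bigl _ _ imE) big_imset /=; last by move=> s t _ _; apply: lift_perm_inj.
  by apply: eq_bigr => s _; rewrite ninv_lift_perm exprD.
rewrite -big_distrl /=; congr (_ * _)%R.
by case: (P 0) => //=; rewrite big_pred1_eq expr0.
Qed.

(** An unmarked position with [n'] positions after it gives the factor [n'.+1]. The last position is
    skipped because its factor is [qint 1 = 1]; [rcons] keeps the list increasing, as the first
    position gives the largest factor. *)
Fixpoint right_min_factors (n : nat) (P : pred nat) : seq nat :=
  if n is n'.+1 then
    let s := right_min_factors n' (fun i => P i.+1) in
    if P 0 || (n' == 0) then s else rcons s n'.+1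
  else [::].

Lemma right_min_factors_bound n P : all (fun i => 2 <= i <= n) (right_min_factors n P).
Proof.
elim: n P => //= n IH P; have := IH (fun i => P i.+1).
have sub s : all (fun i => 2 <= i <= n) s -> all (fun i => 1 < i <= n.+1) s.
  by apply: sub_all => i; lia.
case: ifP => [_ /sub //|/norP[_ n0] /sub]; rewrite all_rcons => ->.
by rewrite andbT; lia.
Qed.

Lemma right_min_factors_sorted n P : sorted ltn (right_min_factors n P).
Proof.
elim: n P => //= n IH P; case: ifP => // _.
have := right_min_factors_bound n (fun i => P i.+1); have := IH (fun i => P i.+1).
case: (right_min_factors _ _) => //= a s srt /andP[an /allP bd].
rewrite rcons_path srt /=; have := mem_last a s.
by rewrite inE => /orP[/eqP ->|/bd]; rewrite /ltn /=; lia.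
Qed.

Lemma right_min_gf n P :
  (\sum_(w in right_min n P) 'X^(ninv w) =
   \prod_(i <- right_min_factors n P) qint i :> {poly int})%R.
Proof.
elim: n P => [|n IH] P.
  rewrite big_nil (eq_bigl (pred1 1%g)).
    by rewrite big_pred1_eq ninv_id expr0.
  by move=> w; rewrite [RHS]/=; have -> : w = 1%g; [apply/permP => -[]|rewrite right_min_id eqxx].
rewrite right_min_gf_rec IH /=; case: (P 0) => /=; first by rewrite mul1r.
case: eqP => [->|_]; first by rewrite /qint big_ord_recl big_ord0 expr0 addr0 mul1r.
by rewrite -cats1 big_cat big_seq1 mulrC.
Qed.

(** * Products of q-integers *)

Section SymmetricUnimodal.
Local Open Scope ring_scope.

(** The centre of symmetry is [d / 2]. Growth is required only on the lower half; the descent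
    follows by symmetry. *)
Definition sym_unimodal (d : nat) (p : {poly int}) : Prop :=
  [/\ forall i, (d < i)%N -> p`_i = 0,
      forall i, (i <= d)%N -> p`_i = p`_(d - i),
      forall i, 0 <= p`_i
    & forall i, (i.*2 < d)%N -> p`_i <= p`_i.+1].

Lemma sym_unimodal1 : sym_unimodal 0 1.
Proof.
split=> [i|i|i|//]; rewrite ?coef1 //; first by case: i.
by rewrite leqn0 => /eqP ->.
Qed.

(** The index [j] is at least as close to the centre as [i]; if it lies past the middle, reflect it
    to [d - j], which is still at least [i]. *)
Lemma sym_unimodal_le d p i j : sym_unimodal d p ->
  (i <= j)%N -> (i + j <= d)%N -> p`_i <= p`_j.
Proof.
case=> p0 psym pge pmono.
have mono k l : (k <= l)%N -> (l.*2 <= d.+1)%N -> p`_k <= p`_l.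
  move=> kl; have := kl; elim: l => [|l IH] in kl *; first by rewrite leqn0 => /eqP ->.
  rewrite leq_eqVlt => /orP[/eqP -> //|kl1] ld.
  by apply: le_trans (IH _ _ _) (pmono _ _); lia.
move=> ij ijd; have [jd|jd] := leqP j.*2 d.+1; first exact: mono.
by rewrite (psym j) //; [apply: mono; lia|lia].
Qed.

Lemma coef_qintM r (p : {poly int}) i :
  (qint r * p)`_i = \sum_(j < r) (if (i < j)%N then 0 else p`_(i - j)).
Proof.
by rewrite /qint mulr_suml coef_sum; apply: eq_bigr => j _; rewrite coefXnM.
Qed.

(** Coefficients of the product are sums of [p] over a window of length [r.+1]; sliding it by one
    gains one term and loses one. *)
Lemma coef_qintMS r (p : {poly int}) i :
  (qint r.+1 * p)`_i.+1 = (qint r.+1 * p)`_i + p`_i.+1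
     - (if (i < r)%N then 0 else p`_(i - r)).
Proof.
rewrite !coef_qintM big_ord_recl subn0 [in RHS]big_ord_recr /=.
rewrite [RHS]addrAC addrK addrC; congr (_ + _).
Qed.

Lemma sym_unimodalM d r p :
  sym_unimodal d p -> sym_unimodal (d + r) (qint r.+1 * p).
Proof.
move=> su; have [p0 psym pge pmono] := su.
split=> [i di|i di|i|i di].
- rewrite coef_qintM big1 // => j _; case: ifP => // ij.
  by apply: p0; have := ltn_ord j; lia.
- rewrite !coef_qintM (reindex_inj rev_ord_inj) /=; apply: eq_bigr => j _.
  have jr := ltn_ord j.
  case: ifP => ij; case: ifP => ij' //.
  + by rewrite p0 //; lia.
  + by rewrite p0 //; lia.
  + have [dij|dij] := leqP (i - (r.+1 - j.+1)) d.
      by rewrite psym //; congr (p`_ _); lia.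
    by lia.
- by rewrite coef_qintM sumr_ge0 // => j _; case: ifP.
(* The increment is [p_(i+1) - p_(i-r)], and [(i + 1) + (i - r) <= d] holds on the lower half of the
   product. *)
- rewrite coef_qintMS -addrA lerDl subr_ge0; case: ifP => // ir.
  by apply: sym_unimodal_le su _ _; lia.
Qed.

Lemma sym_unimodal_prod (s : seq nat) : all (leq 1) s ->
  sym_unimodal (\sum_(i <- s) i.-1)%N (\prod_(i <- s) qint i).
Proof.
elim: s => [|[//|r] s IH] /=; first by rewrite !big_nil => _; apply: sym_unimodal1.
by rewrite !big_cons addnC => /IH; apply: sym_unimodalM.
Qed.

Lemma coef_rank_gf (T : finType) (rk : T -> nat) (C : {set T}) i :
  (\sum_(w in C) 'X^(rk w) : {poly int})`_i = (rank_number rk C i)%:R.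
Proof.
rewrite coef_sum /rank_number -sum1_card natr_sum big_mkcond [RHS]big_mkcond /=.
apply: eq_bigr => w _; rewrite coefXn inE eq_sym.
by case: (w \in C); case: eqP.
Qed.

Lemma sym_unimodal_rank (T : finType) (le : rel T) (rk : T -> nat) (C : {set T})
    (d : nat) (p : {poly int}) (x0 m : T) :
  rank_function le rk C -> maximum_in le C m ->
  (forall x y, le x y -> rk x <= rk y)%N ->
  x0 \in C -> rk x0 = 0%N ->
  (\sum_(w in C) 'X^(rk w)) = p -> sym_unimodal d p ->
  rank_unimodal le rk C /\ rank_symmetric le rk C.
Proof.
move=> rkf mmax rk_le x0C rkx0 gf [p0 psym pge pmono].
have coefE i : p`_i = (rank_number rk C i)%:R by rewrite -gf coef_rank_gf.
have [mC mP] := mmax.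
have rank_pos x : x \in C -> (0 < rank_number rk C (rk x))%N.
  by move=> xC; apply/card_gt0P; exists x; rewrite inE xC eqxx.
have rkm : rk m = d.
  (* The coefficient at [rk m] is nonzero, so [rk m <= d]. By symmetry the coefficient at [d] equals
     the one at 0, which counts [x0], so some element has rank [d]. *)
  apply/eqP; rewrite eqn_leq; apply/andP; split.
    rewrite leqNgt; apply/negP => /p0; rewrite coefE => /eqP.
    by rewrite pnatr_eq0 => /eqP e; have := rank_pos m mC; rewrite e.
  have : (0 < rank_number rk C d)%N.
    have := psym 0%N isT; rewrite subn0 !coefE => /eqP; rewrite eqr_nat => /eqP <-.
    by have := rank_pos _ x0C; rewrite rkx0.
  by case/card_gt0P => x; rewrite inE => /andP[xC /eqP <-]; apply/rk_le/mP.
have sym i : (i <= d)%N -> rank_number rk C i = rank_number rk C (d - i).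
  by move/psym; rewrite !coefE => /eqP; rewrite eqr_nat => /eqP.
have mono i : (i.*2 < d)%N -> (rank_number rk C i <= rank_number rk C i.+1)%N.
  by move/pmono; rewrite !coefE ler_nat.
split; split=> //; exists m; rewrite ?rkm //; split=> i.
  by move=> id; apply: mono; lia.
case/andP=> di id.
rewrite (sym i (ltnW id)) (sym i.+1 id).
have e : (d - i = (d - i.+1).+1)%N by lia.
have [h|h] := ltnP (d - i.+1).*2 d.
  by rewrite e; apply: mono.
have -> : (d - i.+1 = i)%N by lia.
by lia.
Qed.

End SymmetricUnimodal.

(** * The standard cyclic form *)

(** Positions are counted from 0; since [k < size lam], the full sum is not included as a partial
    sum. *)
Definition block_starts (lam : seq nat) (p : nat) : bool :=
  p \in [seq sumn (take k lam) | k <- iota 0 (size lam)].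

Lemma block_startsP lam p :
  reflect (exists2 k, k < size lam & p = sumn (take k lam)) (block_starts lam p).
Proof.
by apply: (iffP mapP) => -[k kP ->]; exists k => //; move: kP; rewrite mem_iota.
Qed.

Section CyclicForm.
Variable n : nat.
Implicit Types (p w : 'S_n) (s : seq 'I_n) (ss : seq (seq 'I_n)).

Lemma drop_flatten k ss :
  drop (sumn (take k (shape ss))) (flatten ss) = flatten (drop k ss).
Proof.
elim: ss k => [|s ss IH] [|k] //=; first by rewrite drop0.
by rewrite drop_cat ltnNge leq_addr /= addKn IH.
Qed.

Lemma ord_ltn_trans : transitive (fun i j : 'I_n => i < j).
Proof. by move=> j i k; apply: ltn_trans. Qed.

Lemma sorted_cycle_mins p : sorted (fun i j : 'I_n => i < j) [seq x <- enum 'I_n | cycle_min p x].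
Proof.
apply: (sorted_filter ord_ltn_trans).
by have := iota_ltn_sorted 0 n; rewrite -val_enum_ord sorted_map.
Qed.

(** A block start carries the minimum of its cycle, and all later cycles have larger minima. *)
Lemma C_sub_right_min lam : C_ n lam \subset right_min n (block_starts lam).
Proof.
apply/subsetP => _ /imsetP[p pA ->].
have /eqP plam : composition_type p == lam by move: pA; rewrite inE.
apply/right_minP => i j /block_startsP[k _ ik] ij.
suff le_ij : Omega p i <= Omega p j.
  rewrite ltn_neqAle le_ij andbT (inj_eq val_inj) (inj_eq perm_inj).
  by apply/eqP => e; rewrite e ltnn in ij.
rewrite !(Omega_one_line _ i).
(* Both entries are read in the suffix starting at [i], which consists of whole cycles. *)
have jE : nth i (Omega_word p) j = nth i (drop i (Omega_word p)) (j - i).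
  by rewrite nth_drop subnKC // ltnW.
have iE : nth i (Omega_word p) i = nth i (drop i (Omega_word p)) 0.
  by rewrite nth_drop addn0.
have jmem : nth i (Omega_word p) j \in drop i (Omega_word p).
  by rewrite jE mem_nth // size_drop size_Omega_word ltn_sub2r // ltn_ord.
move: jmem; rewrite iE ik -plam /Omega_word drop_flatten /standard_cyclic_form.
rewrite -map_drop.
have mins x : x \in drop k [seq x <- enum 'I_n | cycle_min p x] -> cycle_min p x.
  by move/mem_drop; rewrite mem_filter => /andP[].
have := drop_sorted k (sorted_cycle_mins p); move: mins.
case: (drop k _) => [|x s] mins //= srt.
have cw0 : exists t, cycle_word p x = x :: t.
  rewrite /cycle_word; case: #|_| (card_porbit_neq0 p x) => // m _.
  by exists (traject p (p x) m).
have -> : nth i (cycle_word p x ++ flatten [seq cycle_word p x | x <- s]) 0 = x.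
  by have [t ->] := cw0.
set y := nth i _ j.
have cyc_le z : z \in x :: s -> y \in cycle_word p z -> z <= y.
  move=> /mins /forallP/(_ y)/implyP zmin; rewrite mem_cycle_word; exact: zmin.
rewrite mem_cat => /orP[|/flattenP[_ /mapP[z zs ->] yz]].
  by apply: cyc_le; rewrite mem_head.
apply: leq_trans (cyc_le z _ yz); last by rewrite inE zs orbT.
by apply: ltnW; apply: (allP (order_path_min ord_ltn_trans srt)).
Qed.

(** * Rebuilding a permutation from its cycles *)

Definition block_of ss (y : 'I_n) : seq 'I_n :=
  nth [::] ss (find (fun s => y \in s) ss).

Lemma block_ofE ss s y : uniq (flatten ss) -> s \in ss -> y \in s ->
  block_of ss y = s.
Proof.
rewrite /block_of; elim: ss => //= t ss IH; rewrite cat_uniq => /and3P[_ dis us].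
rewrite inE => /orP[/eqP ->|s_ss] ys; first by rewrite ys.
case: ifP => [yt|_] /=; last exact: IH.
by case/hasP: dis; exists y => //; apply/flattenP; exists s.
Qed.

Lemma uniq_block ss s : uniq (flatten ss) -> s \in ss -> uniq s.
Proof.
elim: ss => //= t ss IH; rewrite cat_uniq inE => /and3P[ut _ /IH H].
by case/orP => [/eqP ->|].
Qed.

(** Moving to the next entry of a block stays in that block, so [prev] undoes it. *)
Lemma next_block_inj ss : uniq (flatten ss) -> (forall y, y \in flatten ss) ->
  injective (fun y => next (block_of ss y) y).
Proof.
move=> us full; apply: (can_inj (g := fun y => prev (block_of ss y) y)) => y.
have /flattenP[s sss ys] := full y.
rewrite (block_ofE us sss ys) (block_ofE us sss) ?mem_next //.
exact: prev_next (uniq_block us sss) y.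
Qed.

Lemma fcycle_cycle_word p x s : uniq (x :: s) -> fcycle p (x :: s) ->
  cycle_word p x = x :: s.
Proof.
move=> us cyc.
have closed y : y \in x :: s -> p y \in x :: s.
  by move=> ys; rewrite (eqP (next_cycle cyc ys)) mem_next.
have sE : x :: s = traject p x (size s).+1.
  by move: cyc; rewrite /= rcons_path => /andP[/fpathE -> _]; rewrite size_traject.
have orbE : porbit p x =i x :: s.
  move=> y; apply/idP/idP => [/porbitP[i ->]|].
    elim: i => [|i IH]; first by rewrite expg0 perm1 mem_head.
    by rewrite expgSr permM closed.
  rewrite sE => /trajectP[i _ ->]; rewrite -permX; exact: mem_porbit.
by rewrite /cycle_word (eq_card orbE) (card_uniqP us) -sE.
Qed.

(** One condition covers both rules of the standard form: a head is below the rest of its block and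
    below all later heads. *)
Fixpoint increasing_blocks ss : bool :=
  if ss is s :: ss' then
    (if s is x :: t then all (fun y : 'I_n => x < y) (t ++ flatten ss') else false)
      && increasing_blocks ss'
  else true.

Lemma increasing_blocks_heads p ss : increasing_blocks ss ->
  (forall x s, x :: s \in ss -> cycle_word p x = x :: s) ->
  exists h, [/\ ss = [seq cycle_word p x | x <- h],
    pairwise (fun i j : 'I_n => i < j) h & {in h, forall x, cycle_min p x}].
Proof.
elim: ss => [|[|x s] ss IH] //=; first by exists [::].
case/andP; rewrite all_cat => /andP[/allP xs /allP xss] inc cwE.
have [|h [hE hsrt hmin]] := IH inc; first by move=> y t yt; apply: cwE; rewrite inE yt orbT.
exists (x :: h); split.
- by rewrite /= -hE (cwE x s) ?mem_head.
- rewrite /= hsrt andbT; apply/allP => y yh; apply: xss.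
  rewrite hE; apply/flattenP; exists (cycle_word p y); first exact: map_f.
  by rewrite mem_cycle_word porbit_id.
- move=> y; rewrite inE => /orP[/eqP ->|]; last exact: hmin.
  apply/forallP => z; apply/implyP.
  by rewrite -mem_cycle_word (cwE x s) ?mem_head // inE => /orP[/eqP -> //|/xs/ltnW].
Qed.

(** The permutation sends each entry to the cyclically next one in its block, so that its cycles are
    the blocks. *)
Lemma cyclic_form_of_blocks ss :
  uniq (flatten ss) -> (forall y, y \in flatten ss) -> increasing_blocks ss ->
  exists p, standard_cyclic_form p = ss.
Proof.
move=> us full inc; pose p := perm (next_block_inj us full); exists p.
have cwE x s : x :: s \in ss -> cycle_word p x = x :: s.
  move=> sss; have u := uniq_block us sss.
  apply: fcycle_cycle_word => //.
  rewrite -(eq_in_cycle (P := mem (x :: s)) (e := frel (next (x :: s)))) ?cycle_next //.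
    by move=> y z ys _; rewrite /= permE (block_ofE us sss ys).
  exact/allP.
have [h [hE hsrt hmin]] := increasing_blocks_heads inc cwE.
rewrite /standard_cyclic_form [RHS]hE; congr map.
(* The cycle minima and the block heads are two strictly increasing lists, so equality of their sets
   of members suffices. *)
apply: (irr_sorted_eq ord_ltn_trans) => [i| | |x]; first exact: ltnn.
- exact: sorted_cycle_mins.
- by rewrite (sorted_pairwise ord_ltn_trans).
rewrite mem_filter mem_enum andbT; apply/idP/idP => [xmin|]; last exact: hmin.
have := full x; rewrite hE => /flattenP[_ /mapP[z zh ->]]; rewrite mem_cycle_word => xz.
have le_zx : z <= x by have /forallP/(_ x)/implyP := hmin z zh; apply.
have le_xz : x <= z by have /forallP/(_ z)/implyP := xmin; apply; rewrite porbit_sym.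
suff -> : x = z by [].
by apply/val_inj/eqP; rewrite eqn_leq le_xz.
Qed.

Lemma increasing_blocks_reshape x0 lam (u : seq 'I_n) :
  all (leq 1) lam -> size u = sumn lam ->
  (forall i j, block_starts lam i -> i < j -> j < size u -> nth x0 u i < nth x0 u j) ->
  increasing_blocks (reshape lam u).
Proof.
elim: lam u => [|[//|a] lam IH] [|x u] //= lam_pos [szu] uP.
rewrite reshapeKr ?size_drop ?szu ?addKn // cat_take_drop; apply/andP; split.
  apply/(all_nthP x0) => j ju; apply: (uP 0 j.+1) => //.
apply: IH => //; first by rewrite size_drop szu addKn.
move=> i j /block_startsP[k klt ik] ij; rewrite size_drop ltn_subRL => ju.
rewrite !nth_drop; apply: (uP (a + i).+1 (a + j).+1); rewrite ?ltnS ?ltn_add2l //.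
by apply/block_startsP; exists k.+1; rewrite //= ik.
Qed.

(** For the converse inclusion, cut the one-line word of [w] into blocks of lengths [lam]; they form
    the standard cyclic form of a preimage under [Omega]. *)
Lemma C_right_min lam : is_composition n lam -> C_ n lam = right_min n (block_starts lam).
Proof.
case=> lam_pos lam_sum; apply/eqP; rewrite eqEsubset C_sub_right_min /=.
apply/subsetP => w /right_minP wP; pose u := codom w.
have szu : size u = n by rewrite size_codom card_ord.
have flatE : flatten (reshape lam u) = u by rewrite reshapeKr // szu lam_sum.
have nth_u (i j : 'I_n) : nth i u j = w j.
  by rewrite (nth_map i) ?size_enum_ord // nth_ord_enum.
have inc : increasing_blocks (reshape lam u).
  case: (posnP n) => [n0|n_gt0].
    by have := etrans lam_sum n0; move: lam_pos; case: (lam) => // -[].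
  apply: (@increasing_blocks_reshape (Ordinal n_gt0)) => //; first by rewrite szu lam_sum.
  rewrite szu => i j iP ij jn; have iN := ltn_trans ij jn.
  have := wP (Ordinal iN) (Ordinal jn) iP ij.
  by rewrite -!(nth_u (Ordinal n_gt0)).
have [||p pE] := cyclic_form_of_blocks _ _ inc; rewrite ?flatE.
- by rewrite map_inj_uniq ?enum_uniq //; apply: perm_inj.
- by move=> y; apply/codomP; exists (w^-1 y)%g; rewrite permKV.
apply/imsetP; exists p.
  by rewrite inE /composition_type pE reshapeKl // szu lam_sum.
by apply/permP => i; rewrite (Omega_one_line _ i) /Omega_word pE flatE nth_u.
Qed.

End CyclicForm.

Theorem theoremB (n : nat) (lam : seq nat) (hlam : is_composition n lam) :
  [/\ rank_unimodal (@bruhat n) (@ninv n) (C_ n lam),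
      rank_symmetric (@bruhat n) (@ninv n) (C_ n lam)
    & exists s : seq nat,
        [/\ sorted ltn s,
            all (fun i => 2 <= i <= n - 1) s
          & (\sum_(w in C_ n lam) 'X^(ninv w) = \prod_(i <- s) qint i :> {poly int})%R]].
Proof.
rewrite (C_right_min hlam); set P := block_starts lam.
have bound := right_min_factors_bound n P.
have pos : all (leq 1) (right_min_factors n P) by apply: sub_all bound => i; lia.
have [m mP] := right_min_maximum n P.
have [|uni sym] := sym_unimodal_rank (right_min_rank_function n P) mP _
    (right_min_id n P) (ninv_id n) (right_min_gf n P) (sym_unimodal_prod pos).
  by move=> x y /bruhat_ninv[->|/ltnW].
split=> //; exists (right_min_factors n P); split.
- exact: right_min_factors_sorted.
(* Position 0 is always a block start, so the largest possible factor [n] never occurs and the bound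
   drops to [n - 1]. *)
- case: n hlam @P {bound pos m mP uni sym} => [|n] [lam_pos lam_sum] //=.
  have -> /= : block_starts lam 0.
    by case: lam lam_pos lam_sum => // a lam _ _; apply/block_startsP; exists 0.
  by rewrite subn1; apply: right_min_factors_bound.
- exact: right_min_gf.
Qed.
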